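(* Let $H$ be an infinite-dimensional Hilbert space. Then $$\{T\in\mathcal{B}(H) : \|Tx\|\ge\|x\|\ \text{for all } x\in H\}=\overline{\{T\in\mathcal{B}(H) : T \text{ is a } 2\text{-isometry}\}}^{SOT}.$$
   Context: $\mathcal{B}(H)$ denotes the bounded linear operators on $H$. An operator $T\in\mathcal{B}(H)$ is called a $2$-isometry if $1-2T^*T+{T^*}^2T^2=0$, where $1$ is the identity operator. SOT denotes the strong operator topology on $\mathcal{B}(H)$ (the topology of pointwise norm convergence of nets: $T_\alpha\to T$ iff $\|T_\alpha x-Tx\|\to 0$ for every $x\in H$), and $\overline{\,\cdot\,}^{SOT}$ is the topological closure with respect to it (i.e. under nets, not only sequences). *)

(* Defs.v *)
From HB Require Import structures.
From mathcomp Require Import all_boot all_order all_algebra sesquilinear complex.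
From mathcomp Require Import all_classical all_reals topology normedtype.

Set Implicit Arguments.
Unset Strict Implicit.
Unset Printing Implicit Defensive.

Import Order.TTheory GRing.Theory Num.Theory.

Local Open Scope classical_set_scope.
Local Open Scope ring_scope.

(* The scalar field [K] of a Hilbert space is the field of real or of complex
   numbers; [conj] is its conjugation. *)
Variant real_or_complex (R : realType) :
    forall K : numFieldType, (K -> K) -> Prop :=
| RealScalars : @real_or_complex R R idfun
| ComplexScalars : @real_or_complex R R[i] (@Num.conj R[i]).

Definition infinite_dimensional (K : numFieldType) (H : lmodType K) : Prop :=
  ~ exists (n : nat) (e : 'I_n -> H),
      forall x : H, exists a : 'I_n -> K, x = \sum_(i < n) a i *: e i.

(* [{ptws H -> H}] carries the topology of pointwise norm convergence, and a
   set coerced to a type carries the subspace topology: the topology of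
   [bounded_operator H] is the strong operator topology. *)
Definition bounded_linear (K : numFieldType) (H : normedModType K) :
    set {ptws H -> H} :=
  [set T : {ptws H -> H} | linear (T : H -> H) /\
    exists M : K, forall x : H, `|T x| <= M * `|x|].

Definition bounded_operator (K : numFieldType) (H : normedModType K) : Type :=
  set_type (@bounded_linear K H).

HB.instance Definition _ (K : numFieldType) (H : normedModType K) :=
  Topological.copy (bounded_operator H) (set_type (@bounded_linear K H)).

Definition bounded_operator_fun (K : numFieldType) (H : normedModType K)
    (T : bounded_operator H) : H -> H :=
  set_val T.
Coercion bounded_operator_fun : bounded_operator >-> Funclass.

Definition is_adjoint (K : numFieldType) (conj : K -> K) (H : normedModType K)
    (dot : {dot H for conj}) (T S : bounded_operator H) : Prop :=
  forall x y : H, dot (T x) y = dot x (S y).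

(* On a Hilbert space the adjoint [S] exists and is unique. *)
Definition two_isometry (K : numFieldType) (conj : K -> K)
    (H : normedModType K) (dot : {dot H for conj})
    (T : bounded_operator H) : Prop :=
  exists2 S : bounded_operator H, is_adjoint dot T S &
    forall x : H, x - 2%:R *: S (T x) + S (S (T (T x))) = 0.

(* Main.v *)
Require Import Defs.
From HB Require Import structures.
From mathcomp Require Import all_boot all_order all_algebra sesquilinear complex.
From mathcomp Require Import all_classical all_reals topology normedtype.
From mathcomp Require Import sequences ring.

(** A 2-isometry S satisfies |S^n x|^2 = |x|^2 + n (|S x|^2 - |x|^2). The left
    side is nonnegative for all n, so |S x| >= |x| ([two_isometric_expansive]).
    This inequality survives pointwise limits, which gives one inclusion.

    For the other one, let T be expansive. A strong neighbourhood of T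
    constrains finitely many vectors, hence it is enough to control an operator
    on an orthonormal family x_0, ..., x_(m-1). The 2-isometries that do it are
    of the form U S_0 with an isometry U and, for a decomposition of the space
    as H_1 + H_2 with dim H_2 = m,

        S_0 = [ L  V ]
              [ 0  1 ],

    where L is isometric and V is an arbitrary operator whose range is
    orthogonal to that of L; U is the identity on H_2. The defect S^*S - 1 of
    S = U S_0 is V^*V, carried by H_2, and S does not change the component in
    H_2. Hence S^* (S^*S - 1) S = S^*S - 1, which says that S is a 2-isometry,
    however large V is ([two_isometric_model]).

    This freedom in the size of V creates the expansion. Let 0 < b < 1 and
    a^2 + b^2 = 1, choose new orthonormal vectors q_i and let H_2 be spanned by
    p_i = b x_i + a q_i. For small b the x_i are almost in H_1, and yet S_0
    can add any prescribed vectors c_i to their components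
    h_i = x_i - b p_i. The isometry U, fixing the p_i, has to map h_i + c_i to
    z_i, the component of T x_i orthogonal to H_2. By [isometry_extension] it
    exists as soon as the Gram matrices agree, that is, if the c_i, taken
    orthogonal to everything else, have the Gram matrix of the form

        <T u, T w> - b^2 sum_j <T u, x_j> <x_j, T w> - a^2 <u, w>

    on the x_i. By Bessel's inequality and because T is expansive this form is
    positive semidefinite, so such c_i exist by [psd_gram]. The resulting S
    sends x_i to T x_i up to an error of order b
    ([two_isometric_interpolation]).

    Infinite dimension provides the room: the isometry L of [exists_shift] fixes
    finitely many given vectors and has a range orthogonal to m further
    orthonormal vectors, of which the c_i are combinations. *)

Import Order.TTheory GRing.Theory Num.Theory.

Local Open Scope classical_set_scope.
Local Open Scope ring_scope.

Set Implicit Arguments.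
Unset Strict Implicit.

(** * Positive semidefinite sesquilinear forms *)

Section PositiveForms.
Variables (K : numFieldType) (conj : {rmorphism K -> K}) (V : lmodType K).
Hypothesis conjK : involutive conj.
Hypothesis conj_norm : forall a : K, `|a| ^+ 2 = a * conj a.

Record psd_form (B : V -> V -> K) : Prop := PsdForm {
  psd_linear : forall a u v w, B (a *: u + v) w = a * B u w + B v w;
  psd_conj : forall u v, conj (B u v) = B v u;
  psd_ge0 : forall u, 0 <= B u u }.

Lemma conj_ge0 (a : K) : 0 <= a -> conj a = a.
Proof.
have [->|a0 age] := eqVneq a 0; first by rewrite rmorph0.
by apply: (mulfI a0); rewrite -conj_norm ger0_norm.
Qed.

Lemma psd_linearr (B : V -> V -> K) : psd_form B ->
  forall a u v w, B w (a *: u + v) = conj a * B w u + B w v.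
Proof.
by move=> hB a u v w; rewrite -(psd_conj hB) (psd_linear hB) rmorphD rmorphM
  !(psd_conj hB).
Qed.

(** Expand B (a v + u) (a v + u) >= 0. If B v v > 0, take a = - B u v / B v v.
    If B v v = 0, the expansion is affine along the multiples of B u v, so a
    large negative multiple contradicts positivity unless B u v = 0. *)
Lemma psd_cauchy_schwarz (B : V -> V -> K) : psd_form B ->
  forall u v, B u v * B v u <= B u u * B v v.
Proof.
move=> hB u v.
have E a : B (a *: v + u) (a *: v + u) =
    a * conj a * B v v + a * B v u + conj a * B u v + B u u.
  by rewrite (psd_linear hB) !(psd_linearr hB); ring.
have ge0 a : 0 <= a * conj a * B v v + a * B v u + conj a * B u v + B u u.
  by rewrite -E; exact: psd_ge0 hB _.
have [v0|v0] := eqVneq (B v v) 0.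
  rewrite v0 mulr0.
  have [->|c0] := eqVneq (B u v) 0; first by rewrite mul0r.
  have cv : conj (B u v) = B v u := psd_conj hB u v.
  have pos : 0 < B u v * B v u by rewrite -cv -conj_norm exprn_gt0 ?normr_gt0.
  have n0 := lt0r_neq0 pos.
  (* with a = - t B u v the form takes the value - (B u u + 2) *)
  pose t := (B u u + 1) / (B u v * B v u).
  have ct : conj t = t.
    rewrite /t fmorph_div rmorphD rmorph1 (psd_conj hB) rmorphM !(psd_conj hB).
    by rewrite (mulrC (B v u)).
  have := ge0 (- (t * B u v)).
  rewrite v0 mulr0 add0r rmorphN rmorphM ct cv.
  have -> : - (t * B u v) * B v u + - (t * B v u) * B u v + B u u =
      - (B u u + 2).
    have e : t * (B u v * B v u) = B u u + 1 by rewrite /t divfK.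
    transitivity (- 2 * (t * (B u v * B v u)) + B u u); first by ring.
    by rewrite e; ring.
  rewrite oppr_ge0 => h; have := lt_le_trans _ h => /(_ 0).
  by rewrite ltr_wpDl ?ltxx ?(psd_ge0 hB)// => /(_ isT).
have pos : 0 < B v v by rewrite lt0r v0 (psd_ge0 hB).
have := ge0 (- (B u v / B v v)).
rewrite rmorphN fmorph_div !(psd_conj hB).
have -> : - (B u v / B v v) * - (B v u / B v v) * B v v +
    - (B u v / B v v) * B v u + - (B v u / B v v) * B u v + B u u =
    B u u - B u v * B v u / B v v by field.
by rewrite subr_ge0 ler_pdivrMr.
Qed.

Hypothesis sqrt_ex : forall a : K, 0 <= a -> exists2 b, 0 <= b & b ^+ 2 = a.

(** Cholesky factorization: subtracting from [B] the rank one form of the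
    functional B (., x_n) / sqrt (B x_n x_n) leaves a form that is still positive
    semidefinite, by Cauchy-Schwarz, and is degenerate at x_n. The induction
    must know that the functionals found for the remainder vanish at x_n; hence
    the first conclusion. For x_n of length zero the functional is 0, in
    accordance with division by zero, and nothing is subtracted. *)
Lemma psd_gram (n : nat) (B : V -> V -> K) (x : nat -> V) : psd_form B ->
  exists phi : nat -> V -> K,
    (forall z, (forall y, B z y = 0) -> forall k, phi k z = 0) /\
    forall i y, (i < n)%N ->
      B (x i) y = \sum_(k < n) phi k (x i) * conj (phi k y).
Proof.
elim: n B => [|n IHn] B hB.
  by exists (fun _ _ => 0); split.
have [s s0 s2] := sqrt_ex (psd_ge0 hB (x n)).
have cs := conj_ge0 s0.
have Bs u : s = 0 -> B u (x n) = 0.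
  move=> e; move: (psd_cauchy_schwarz hB u (x n)).
  rewrite -s2 e expr0n mulr0 -(psd_conj hB u) -conj_norm => h.
  by apply/eqP; rewrite -normr_eq0 -sqrf_eq0 eq_le h exprn_ge0.
pose f u := B u (x n) / s.
pose B' u v := B u v - f u * conj (f v).
have hB' : psd_form B'.
  split=> [a u v w|u v|u].
  - by rewrite /B' /f !(psd_linear hB); ring.
  - by rewrite /B' rmorphB rmorphM (psd_conj hB) conjK mulrC.
  - rewrite /B' /f fmorph_div cs (psd_conj hB) mulrACA -invfM -expr2 s2.
    have [e|sn0] := eqVneq s 0.
      by rewrite Bs// !mul0r subr0 (psd_ge0 hB).
    rewrite subr_ge0 ler_pdivrMr ?(psd_cauchy_schwarz hB)//.
    by rewrite -s2 exprn_gt0// lt0r sn0.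
have [phi [phi0 phiE]] := IHn B' hB'.
exists (fun k => if k == n then f else phi k); split.
  move=> z z0 k; case: ifP => _; first by rewrite /f z0 mul0r.
  by apply: phi0 => y; rewrite /B' /f !z0 !mul0r subrr.
have B'n y : B' (x n) y = 0.
  have [e|sn0] := eqVneq s 0.
    by rewrite /B' /f e invr0 !mulr0 mul0r subr0 -(psd_conj hB) Bs// rmorph0.
  rewrite /B' /f fmorph_div cs (psd_conj hB) -s2; field.
  exact: sn0.
move=> i y; rewrite ltnS leq_eqVlt big_ord_recr /= eqxx => /orP[/eqP->|lin].
  rewrite big1 => [|k _]; first by move: (B'n y); rewrite /B' add0r => /subr0_eq.
  by rewrite (ltn_eqF (ltn_ord k)) phi0 ?mul0r.
have := phiE i y lin; rewrite /B' => /eqP; rewrite subr_eq => /eqP ->.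
by congr (_ + _); apply: eq_bigr => k _; rewrite (ltn_eqF (ltn_ord k)).
Qed.

End PositiveForms.
(** * Inner products *)

Section InnerProduct.
Variables (K : numFieldType) (conj : {rmorphism K -> K}).
Hypothesis conjK : involutive conj.
Hypothesis conj_norm : forall a : K, `|a| ^+ 2 = a * conj a.
Variables (H : completeNormedModType K) (dot : {dot H for conj}).
Hypothesis hdot : forall x : H, `|x| ^+ 2 = dot x x.
Local Notation "''[' u , v ]" := (dot u%R v%R) : ring_scope.

Lemma dotC u v : conj '[u, v] = '[v, u].
Proof. by rewrite [RHS]hermC expr0 mul1r. Qed.

Lemma dotZl a u v : '[a *: u, v] = a * '[u, v].
Proof. exact: linearZl_LR. Qed.

Lemma dotZr a u v : '[u, a *: v] = conj a * '[u, v].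
Proof. by rewrite -dotC dotZl rmorphM dotC. Qed.

Lemma dotDl u v w : '[u + v, w] = '[u, w] + '[v, w].
Proof. exact: linearDl. Qed.

Lemma dotDr u v w : '[w, u + v] = '[w, u] + '[w, v].
Proof. exact: linearDr. Qed.

Lemma dotNl u v : '[- u, v] = - '[u, v].
Proof. exact: linearNl. Qed.

Lemma dotNr u v : '[u, - v] = - '[u, v].
Proof. exact: linearNr. Qed.

Lemma dot0l v : '[0, v] = 0.
Proof. exact: linear0l. Qed.

Lemma dot0r v : '[v, 0] = 0.
Proof. exact: linear0r. Qed.

Definition dotE := (dotDl, dotDr, dotNl, dotNr, dotZl, dotZr).

Lemma dot_suml n (F : 'I_n -> H) v : '[\sum_(i < n) F i, v] = \sum_(i < n) '[F i, v].
Proof. exact: linear_sumlz. Qed.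

Lemma dot_sumr n (F : 'I_n -> H) v : '[v, \sum_(i < n) F i] = \sum_(i < n) '[v, F i].
Proof. exact: linear_sumr. Qed.

Lemma dot_psd : psd_form conj dot.
Proof.
split=> [a u v w|u v|u]; first by rewrite !dotE.
- exact: dotC.
- by rewrite -hdot exprn_ge0.
Qed.

Lemma dot_eq0 u : '[u, u] = 0 -> u = 0.
Proof. by rewrite -hdot => /eqP; rewrite sqrf_eq0 normr_eq0 => /eqP. Qed.

Lemma dot_inj u v : (forall w, '[u, w] = '[v, w]) -> u = v.
Proof.
move=> uv; apply/eqP; rewrite -subr_eq0; apply/eqP/dot_eq0.
by rewrite !dotE !uv; ring.
Qed.

Lemma dotC0 u v : '[u, v] = 0 -> '[v, u] = 0.
Proof. by rewrite -dotC => /(congr1 conj); rewrite conjK rmorph0. Qed.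

Lemma ler_norm_dot u v : '[u, u] <= '[v, v] -> `|u| <= `|v|.
Proof. by rewrite -!hdot ler_sqr ?nnegrE. Qed.

Lemma normr_dot1 u : '[u, u] = 1 -> `|u| = 1.
Proof.
by rewrite -hdot => /eqP; rewrite sqrf_eq1 => /orP[/eqP//|/eqP e];
  have := normr_ge0 u; rewrite e oppr_ge0 ler10.
Qed.

Lemma cauchy_schwarz u v : `|'[u, v]| <= `|u| * `|v|.
Proof.
rewrite -ler_sqr ?nnegrE ?mulr_ge0// exprMn !hdot conj_norm dotC.
exact: (psd_cauchy_schwarz conj_norm dot_psd).
Qed.

(** * Bounded operators with an adjoint *)

Definition adjoint (f g : H -> H) := forall x y, '[f x, y] = '[x, g y].

Definition bounded_adjointable (f : H -> H) :=
  (exists g, adjoint f g) /\ exists2 M, 0 <= M & forall x, `|f x| <= M * `|x|.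

Lemma adjointC f g : adjoint f g -> adjoint g f.
Proof. by move=> fg x y; rewrite -dotC -fg dotC. Qed.

(** An operator with an adjoint is automatically linear; this is how the
    linearity of all operators constructed below is obtained. *)
Lemma adjoint_linear f g : adjoint f g -> linear f.
Proof. by move=> fg a u v; apply: dot_inj => w; rewrite !dotE !fg !dotE. Qed.

Lemma adjoint_bounded f g M : adjoint f g -> (forall x, `|f x| <= M * `|x|) ->
  forall x, `|g x| <= M * `|x|.
Proof.
move=> fg fM x; have [->|gx0] := eqVneq (g x) 0.
  by rewrite normr0; apply: le_trans (fM x).
have gp : 0 < `|g x| by rewrite normr_gt0.
rewrite -(ler_pM2l gp) -expr2 hdot -fg mulrCA mulrA.
apply: le_trans (_ : `|'[f (g x), x]| <= _).
  by rewrite fg -hdot ger0_norm ?exprn_ge0.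
by apply: le_trans (cauchy_schwarz _ _) _; rewrite ler_wpM2r.
Qed.

Lemma bounded_adjointable_id : bounded_adjointable idfun.
Proof.
by split; [exists idfun | exists 1 => // x; rewrite mul1r].
Qed.

Lemma bounded_adjointableN f : bounded_adjointable f ->
  bounded_adjointable (fun x => - f x).
Proof.
move=> [[g fg] [M M0 fM]]; split; last first.
  by exists M => // x; rewrite normrN.
by exists (fun x => - g x) => x y; rewrite !dotE fg.
Qed.

Lemma bounded_adjointableD f f' : bounded_adjointable f ->
  bounded_adjointable f' -> bounded_adjointable (fun x => f x + f' x).
Proof.
move=> [[g fg] [M M0 fM]] [[g' fg'] [M' M0' fM']]; split.
  by exists (fun x => g x + g' x) => x y; rewrite !dotE fg fg'.
exists (M + M') => [|x]; first exact: addr_ge0.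
by rewrite mulrDl (le_trans (ler_normD _ _))// lerD.
Qed.

Lemma bounded_adjointable_comp f f' : bounded_adjointable f ->
  bounded_adjointable f' -> bounded_adjointable (f \o f').
Proof.
move=> [[g fg] [M M0 fM]] [[g' fg'] [M' M0' fM']]; split.
  by exists (g' \o g) => x y /=; rewrite fg fg'.
exists (M * M') => [|x]; first exact: mulr_ge0.
by rewrite -mulrA (le_trans (fM _))// ler_wpM2l.
Qed.

Definition finite_rank n (p w : nat -> H) x := \sum_(i < n) '[x, p i] *: w i.

Lemma adjoint_finite_rank n p w : adjoint (finite_rank n p w) (finite_rank n w p).
Proof.
move=> x y; rewrite dot_suml dot_sumr; apply: eq_bigr => i _.
by rewrite !dotE dotC mulrC.
Qed.

Lemma bounded_adjointable_finite_rank n p w :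
  bounded_adjointable (finite_rank n p w).
Proof.
split; first by exists (finite_rank n w p); exact: adjoint_finite_rank.
exists (\sum_(i < n) `|p i| * `|w i|) => [|x].
  by apply: sumr_ge0 => i _; exact: mulr_ge0.
rewrite mulr_suml (le_trans (ler_norm_sum _ _ _))// ler_sum// => i _.
by rewrite normrZ mulrAC ler_wpM2r// mulrC cauchy_schwarz.
Qed.

Definition isometric (f : H -> H) := forall x y, '[f x, f y] = '[x, y].

Lemma isometric_bounded f : isometric f -> forall x, `|f x| <= 1 * `|x|.
Proof. by move=> fi x; rewrite mul1r ler_norm_dot// fi. Qed.

(** * Extension of partial isometries of finite rank *)

(** The map z |-> z - (<z, v> / <x, v>) v with v = x - y is a reflection in the
    real case. Over the complex numbers <x, v> need not be real, and v is
    multiplied by a phase instead of -1; the map is isometric because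
    <v, v> = 2 Re <x, v>. *)
Lemma isometric_swap x y : '[x, x] = '[y, y] ->
  exists f, [/\ bounded_adjointable f, isometric f, f x = y &
                forall z, '[z, x - y] = 0 -> f z = z].
Proof.
move=> xy; have [<-|nxy] := eqVneq x y.
  by exists idfun; split=> //; exact: bounded_adjointable_id.
have [v vE] : exists v, v = x - y by exists (x - y).
have [s sE] : exists s, s = '[x, v] by exists '[x, v].
have vs : '[v, v] = s + conj s.
  by rewrite sE dotC vE !dotE -xy; ring.
have s0 : s != 0.
  apply: contra_neq nxy => s0; apply/subr0_eq/dot_eq0.
  by rewrite -vE vs s0 rmorph0 addr0.
exists (fun z => z + - finite_rank 1 (fun=> v) (fun=> s^-1 *: v) z).
have fE z : finite_rank 1 (fun=> v) (fun=> s^-1 *: v) z = ('[z, v] / s) *: v.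
  by rewrite /finite_rank big_ord_recl big_ord0 addr0 scalerA.
split.
- apply: bounded_adjointableD; first exact: bounded_adjointable_id.
  exact/bounded_adjointableN/bounded_adjointable_finite_rank.
- move=> z w; rewrite !fE !dotE vs fmorph_div !dotC; field.
  by rewrite s0 fmorph_eq0 s0.
- by rewrite fE -sE divff// scale1r vE opprB addrC subrK.
- by rewrite -vE => z zv; rewrite fE zv mul0r scale0r subr0.
Qed.

(** The pairs are treated one at a time. If f already maps the earlier x_j to
    y_j, equality of the Gram matrices says that f x - y is orthogonal to all
    y_j, so the swap of f x and y leaves the earlier values unchanged. *)
Lemma isometry_extension (s : seq (H * H)) :
  (forall u v, u \in s -> v \in s -> '[u.1, v.1] = '[u.2, v.2]) ->
  exists f, [/\ bounded_adjointable f, isometric f &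
                forall u, u \in s -> f u.1 = u.2].
Proof.
elim: s => [|[x y] s IHs] hs.
  by exists idfun; split=> //; exact: bounded_adjointable_id.
have [u v us vs|f [f_adj f_iso fs]] := IHs.
  by apply: hs; rewrite inE ?us ?vs orbT.
have [|g [g_adj g_iso gxy g_id]] := @isometric_swap (f x) y.
  by rewrite f_iso; apply: (hs (x, y) (x, y)); rewrite inE eqxx.
exists (g \o f); split.
- exact: bounded_adjointable_comp.
- by move=> z w /=; rewrite g_iso f_iso.
- move=> u; rewrite inE => /orP[/eqP-> //|us] /=; rewrite fs// g_id// dotDr dotNr.
  by rewrite -{1}(fs u us) f_iso (hs u (x, y)) ?inE ?us ?eqxx ?orbT ?subrr.
Qed.

(** * Finite orthonormal families *)

(** Finite families are restrictions of sequences, so that no casts between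
    index types occur. *)
Definition orthonormal_upto n (o : nat -> H) :=
  forall i j, (i < n)%N -> (j < n)%N -> '[o i, o j] = (i == j)%:R.

Lemma dot_finite_rankl n p w x y :
  '[finite_rank n p w x, y] = \sum_(i < n) '[x, p i] * '[w i, y].
Proof. by rewrite dot_suml; apply: eq_bigr => i _; rewrite dotZl. Qed.

Lemma sum_delta n (F : nat -> K) j : (j < n)%N ->
  \sum_(i < n) F i * (i == j :> nat)%:R = F j.
Proof.
move=> jn; rewrite (bigD1 (Ordinal jn))//= eqxx mulr1 big1 ?addr0// => i.
by rewrite -val_eqE /= => /negbTE ->; rewrite mulr0.
Qed.

Lemma dot_finite_rank_basis n p w x j : orthonormal_upto n w -> (j < n)%N ->
  '[finite_rank n p w x, w j] = '[x, p j].
Proof.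
move=> ow jn; rewrite dot_finite_rankl -[RHS](sum_delta (fun i => '[x, p i]) jn).
by apply: eq_bigr => i _; rewrite ow.
Qed.

Lemma dot_finite_rank2 n p q w x y : orthonormal_upto n w ->
  '[finite_rank n p w x, finite_rank n q w y] = \sum_(i < n) '[x, p i] * '[q i, y].
Proof.
move=> ow; rewrite dot_finite_rankl; apply: eq_bigr => i _.
by rewrite -[X in _ * X]dotC dot_finite_rank_basis// dotC.
Qed.

Lemma finite_rank_orth n p w x : (forall i, (i < n)%N -> '[x, p i] = 0) ->
  finite_rank n p w x = 0.
Proof. by move=> xp; apply: big1 => i _; rewrite xp ?scale0r. Qed.

Lemma finite_rank_eval n p w x c j : (j < n)%N ->
  (forall i, (i < n)%N -> '[x, p i] = c * (i == j)%:R) ->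
  finite_rank n p w x = c *: w j.
Proof.
move=> jn xp; rewrite /finite_rank (bigD1 (Ordinal jn))//= xp// eqxx mulr1.
rewrite big1 ?addr0// => i; rewrite -val_eqE /= => /negbTE ij.
by rewrite xp// ij mulr0 scale0r.
Qed.

Lemma dot_orthogonal_component n p x y : orthonormal_upto n p ->
  '[x - finite_rank n p p x, y - finite_rank n p p y] =
  '[x, y] - \sum_(i < n) '[x, p i] * '[p i, y].
Proof.
move=> op; have yx := dot_finite_rankl n p p x y.
have yy := dot_finite_rank2 p p x y op.
have xy : '[x, finite_rank n p p y] = \sum_(i < n) '[x, p i] * '[p i, y].
  by rewrite -yx (adjoint_finite_rank n p p).
move: yx yy xy; move: (finite_rank n p p x) (finite_rank n p p y) => u v yx yy xy.
by rewrite dotDl !dotDr !dotNl !dotNr yx yy xy opprK addNr addr0.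
Qed.

Lemma bessel n o x : orthonormal_upto n o ->
  \sum_(i < n) '[x, o i] * '[o i, x] <= '[x, x].
Proof.
by move=> oo; rewrite -subr_ge0 -dot_orthogonal_component//; exact: psd_ge0 dot_psd _.
Qed.

Lemma dot_normalize r : r != 0 ->
  [/\ `|r| != 0, conj `|r|^-1 = `|r|^-1 & '[`|r|^-1 *: r, `|r|^-1 *: r] = 1].
Proof.
move=> r0; have nr0 : `|r| != 0 by rewrite normr_eq0.
have cr : conj `|r|^-1 = `|r|^-1 by rewrite (conj_ge0 conj_norm)// invr_ge0.
by split=> //; rewrite dotZl dotZr cr -hdot; field.
Qed.

Lemma gram_schmidt (s : seq H) : exists n o,
  orthonormal_upto n o /\ forall x, x \in s -> finite_rank n o o x = x.
Proof.
elim: s => [|x s [n [o [oo os]]]]; first by exists 0%N, (fun=> 0); split.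
have [r rE] : exists r, r = x - finite_rank n o o x by eexists.
have ro i : (i < n)%N -> '[r, o i] = 0.
  by move=> ?; rewrite rE !dotE dot_finite_rank_basis// subrr.
have [r0|r0] := eqVneq r 0.
  exists n, o; split=> // y; rewrite inE => /orP[/eqP->|/os//].
  by apply/esym/subr0_eq; rewrite -rE.
pose o' i := if i == n then `|r|^-1 *: r else o i.
have o'n : o' n = `|r|^-1 *: r by rewrite /o' eqxx.
have o'i i : (i < n)%N -> o' i = o i by move=> ni; rewrite /o' ltn_eqF.
have e y : finite_rank n.+1 o' o' y =
    finite_rank n o o y + ('[y, o' n]) *: o' n.
  rewrite /finite_rank big_ord_recr /=; congr (_ + _).
  by apply: eq_bigr => i _; rewrite o'i.
have [nr0 cr n1] := dot_normalize r0; rewrite -o'n in n1.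
have no i : (i < n)%N -> '[o' n, o i] = 0.
  by move=> ni; rewrite o'n !dotE ro// mulr0.
exists n.+1, o'; split.
  move=> i j; rewrite !ltnS.
  rewrite leq_eqVlt => /orP[/eqP->|ni]; rewrite leq_eqVlt => /orP[/eqP->|nj].
  - by rewrite n1 eqxx.
  - by rewrite (o'i j)// no// gtn_eqF.
  - by rewrite (o'i i)// dotC0 ?no// ltn_eqF.
  - by rewrite !o'i ?oo.
move=> y; rewrite e inE => /orP[/eqP->|ys].
  rewrite -{2}(subrK (finite_rank n o o x) x) -rE dotDl.
  have -> : '[finite_rank n o o x, o' n] = 0.
    rewrite dot_finite_rankl big1// => i _.
    by rewrite -[X in _ * X]dotC no// rmorph0 mulr0.
  rewrite addr0 o'n dotZr cr -hdot scalerA.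
  have -> : `|r|^-1 * `|r| ^+ 2 * `|r|^-1 = 1 by field.
  by rewrite scale1r rE addrC subrK.
rewrite (os y ys); suff -> : '[y, o' n] = 0 by rewrite scale0r addr0.
rewrite -(os y ys) dot_finite_rankl big1// => i _.
by rewrite -[X in _ * X]dotC no// rmorph0 mulr0.
Qed.

Hypothesis hH : infinite_dimensional H.

Lemma exists_unit_orth (s : seq H) : exists e : H,
  '[e, e] = 1 /\ forall x, x \in s -> '[e, x] = 0.
Proof.
have [n [o [oo os]]] := gram_schmidt s.
have [x xo] : exists x, finite_rank n o o x != x.
  apply: contra_notP hH => /forallNP no; exists n, o => x.
  exists (fun i => '[x, o i]); apply/esym/eqP.
  by have := no x; move/negP; rewrite negbK.
have [r rE] : exists r, r = x - finite_rank n o o x by eexists.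
have r0 : r != 0 by rewrite rE subr_eq0 eq_sym.
have [_ _ r1] := dot_normalize r0; exists (`|r|^-1 *: r); split=> //.
move=> y ys; rewrite dotZl -(os y ys) dot_sumr big1 ?mulr0// => i _.
by rewrite dotZr rE !dotE dot_finite_rank_basis// subrr mulr0.
Qed.

Lemma exists_orthonormal_sequence (s : seq H) : exists e : nat -> H,
  (forall n, orthonormal_upto n e) /\ forall n x, x \in s -> '[e n, x] = 0.
Proof.
have [F FE] := choice exists_unit_orth.
pose L := fix L n := if n is m.+1 then F (L m) :: L m else s.
have Ls n x : x \in s -> x \in L n.
  by move=> xs; elim: n => //= n IHn; rewrite inE IHn orbT.
have Lm i j : (i < j)%N -> F (L i) \in L j.
  elim: j => // j IHj; rewrite ltnS leq_eqVlt inE => /orP[/eqP->|/IHj->].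
    by rewrite eqxx.
  by rewrite orbT.
exists (fun n => F (L n)); split; last first.
  by move=> n x xs; apply: (FE (L n)).2; exact: Ls.
move=> n i j _ _; case: (ltngtP i j) => [ij|ij|->].
- by apply: dotC0; apply: (FE (L j)).2; exact: Lm.
- by apply: (FE (L i)).2; exact: Lm.
- exact: (FE (L j)).1.
Qed.

(** * The shift along an orthonormal sequence *)

Hypothesis archimedean : forall a : K, exists n : nat, `|a| < n%:R.

(** If the tails did not get small, a sum could be increased by [eps] as often as
    desired. The scalars may be complex, hence are only partially ordered, and
    monotone convergence is replaced by this Archimedean argument. *)
Lemma bounded_sum_tail (c : nat -> K) M : (forall i, 0 <= c i) ->
  (forall n, \sum_(i < n) c i <= M) -> forall eps, 0 < eps ->
  exists N, forall n m, (N <= n)%N -> \sum_(n <= i < m) c i < eps.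
Proof.
move=> c0 cM eps e0; apply: contrapT => no.
have step n : exists2 m, (n <= m)%N & eps <= \sum_(n <= i < m) c i.
  apply: contrapT => h; apply: no; exists n => p m np.
  have [pm|/ltnW mp] := leqP p m; last by rewrite big_geq.
  apply: le_lt_trans (_ : \sum_(n <= i < m) c i < eps).
    rewrite (big_cat_nat np)//=.
    by rewrite lerDr sumr_ge0.
  have [eR sR] : eps \is Num.real /\ \sum_(n <= i < m) c i \is Num.real.
    by rewrite !ger0_real ?sumr_ge0// ltW.
  have [em|//] := real_leP eR sR.
  by case: h; exists m => //; exact: leq_trans np pm.
have grow k : exists n, k%:R * eps <= \sum_(i < n) c i.
  elim: k => [|k [n IHk]]; first by exists 0%N; rewrite mul0r big_ord0.
  have [m nm em] := step n; exists m.
  rewrite -natr1 mulrDl mul1r -(big_mkord xpredT) (big_cat_nat (leq0n n) nm)//=.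
  by rewrite big_mkord lerD.
have [k kM] := archimedean (M / eps).
have [n kn] := grow k.
suff : k%:R <= `|M / eps| by move=> /(lt_le_trans kM); rewrite ltxx.
rewrite ger0_norm; last first.
  by rewrite divr_ge0 ?(ltW e0)// (le_trans _ (cM 0%N))// big_ord0.
by rewrite ler_pdivlMr// (le_trans kn).
Qed.

Definition orthonormal (e : nat -> H) := forall i j, '[e i, e j] = (i == j)%:R.

(** The partial isometry sending each e_i to f_i and killing the orthogonal
    complement of the e_i; its adjoint exchanges [e] and [f]. *)
Definition coefficient_series (e f : nat -> H) (x : H) : H :=
  lim ((fun n => finite_rank n e f x) @ \oo).

Lemma norm_sum_orthonormal (e : nat -> H) (a : nat -> K) n m : orthonormal e ->
  `|\sum_(n <= i < m) a i *: e i| ^+ 2 = \sum_(n <= i < m) `|a i| ^+ 2.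
Proof.
move=> oe; rewrite hdot; elim: m => [|m IHm]; first by rewrite !big_geq// dot0l.
have [nm|mn] := leqP n m; last by rewrite !big_geq// dot0l.
rewrite !big_nat_recr//= -IHm conj_norm.
have h : '[\sum_(n <= i < m) a i *: e i, e m] = 0.
  rewrite big_nat; elim/big_ind: _ => [|u v u0 v0|i /andP[_ im]].
  - exact: dot0l.
  - by rewrite dotDl u0 v0 addr0.
  - by rewrite dotZl oe ltn_eqF// mulr0.
move: (\sum_(n <= i < m) a i *: e i) h => S h.
by rewrite !dotE h (dotC0 h) oe eqxx !mulr0 mulr1 add0r addr0.
Qed.

Lemma coefficient_series_cvg e f x : orthonormal e -> orthonormal f ->
  (fun n => finite_rank n e f x) @ \oo --> coefficient_series e f x.
Proof.
move=> oe of'; apply/cvg_ex => /=.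
have -> : (fun n => finite_rank n e f x) = series (fun i => '[x, e i] *: f i).
  by apply/funext => n; rewrite /series /= big_mkord.
apply/cvg_ex/cauchy_cvgP/cauchy_seriesP => eps e0.
have [|||N tail] := @bounded_sum_tail (fun i => `|'[x, e i]| ^+ 2) '[x, x] _ _ (eps ^+ 2).
- by move=> i; rewrite exprn_ge0.
- move=> n; under eq_bigr do rewrite conj_norm dotC.
  by apply: bessel => i j _ _; exact: oe.
- by rewrite exprn_gt0.
exists ([set n | (N <= n)%N], [set n | (N <= n)%N]) => [|[n m] [/= Nn _]].
  by split; exists N.
by rewrite /= -ltr_sqr ?nnegrE ?(ltW e0)//
  (norm_sum_orthonormal (fun i => '[x, e i]) n m of')/=; exact: tail.
Qed.

(** Both sides are limits of inner products; stating it in this form avoids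
    topologizing the scalar field. *)
Lemma dot_lim (u v : nat -> H) l k x y : u @ \oo --> l -> v @ \oo --> k ->
  (forall n, '[u n, y] = '[x, v n]) -> '[l, y] = '[x, k].
Proof.
move=> /cvgrPdist_lt ul /cvgrPdist_lt vk uv; apply/eqP; rewrite -subr_eq0.
apply: contraT => ne; have d0 : 0 < `|'[l, y] - '[x, k]| by rewrite normr_gt0.
move: d0; set d : K := `|_| => d0.
have p z : 0 < d / 2 / (`|z : H| + 1) by rewrite !divr_gt0 ?ltr_wpDl.
have [n [/= un vn]] := filter_ex (filterI (ul _ (p y)) (vk _ (p x))).
have half (z t : H) : `|t| < d / 2 / (`|z| + 1) -> `|t| * `|z| < d / 2.
  rewrite ltr_pdivlMr ?ltr_wpDl//; apply: le_lt_trans.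
  by rewrite ler_wpM2l// lerDl.
suff : d < d / 2 + d / 2 by rewrite -splitr ltxx.
apply: le_lt_trans (ltrD (half _ _ un) (half _ _ vn)).
rewrite /d; have -> : '[l, y] - '[x, k] = '[l - u n, y] - '[x, k - v n].
  by rewrite !dotE uv; ring.
rewrite (le_trans (ler_normB _ _))// lerD ?cauchy_schwarz//.
by rewrite mulrC cauchy_schwarz.
Qed.

Lemma adjoint_coefficient_series e f : orthonormal e -> orthonormal f ->
  adjoint (coefficient_series e f) (coefficient_series f e).
Proof.
move=> oe of' x y; apply: (dot_lim (coefficient_series_cvg (x := x) oe of')
  (coefficient_series_cvg (x := y) of' oe)).
by move=> n; exact: adjoint_finite_rank.
Qed.

Lemma coefficient_series_orth e f x : (forall i, '[x, e i] = 0) ->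
  coefficient_series e f x = 0.
Proof.
move=> xe; rewrite /coefficient_series.
have -> : (fun n => finite_rank n e f x) = (fun=> 0).
  by apply/funext => n; apply: finite_rank_orth => i _.
exact: lim_cst.
Qed.

Lemma coefficient_series_basis e f i : orthonormal e -> orthonormal f ->
  coefficient_series e f (e i) = f i.
Proof.
move=> oe of'; apply: cvg_lim => //.
apply: cvg_near_cst; exists i.+1 => // n /= ni.
rewrite (@finite_rank_eval n e f (e i) 1 i) ?scale1r// => j _.
by rewrite oe mul1r eq_sym.
Qed.

Lemma dot_coefficient_series e f x i : orthonormal e -> orthonormal f ->
  '[coefficient_series e f x, f i] = '[x, e i].
Proof.
by move=> oe of'; rewrite (adjoint_coefficient_series oe of')
  coefficient_series_basis.
Qed.

Lemma coefficient_series_comp e f x : orthonormal e -> orthonormal f ->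
  coefficient_series f e (coefficient_series e f x) = coefficient_series e e x.
Proof.
move=> oe of'; rewrite /coefficient_series; congr (lim (_ @ \oo)).
apply/funext => n; apply: eq_bigr => i _.
by rewrite dot_coefficient_series.
Qed.

(** The shift e_i |-> e_(i + m) along an orthonormal sequence orthogonal to [s],
    extended by the identity to the orthogonal complement of the sequence; the
    vectors missed are e_0, ..., e_(m-1). *)
Lemma exists_shift (s : seq H) m : exists (L : H -> H) (g : nat -> H),
  [/\ bounded_adjointable L, isometric L, orthonormal_upto m g,
      forall x, x \in s -> L x = x /\ forall k, '[g k, x] = 0 &
      forall x k, (k < m)%N -> '[L x, g k] = 0].
Proof.
have [e [oe' es]] := exists_orthonormal_sequence s.
have oe : orthonormal e by move=> i j; apply: (oe' (maxn i j).+1);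
  rewrite ltnS ?leq_maxl ?leq_maxr.
pose f i := e (i + m)%N.
have of' : orthonormal f by move=> i j; rewrite oe eqn_add2r.
pose P := coefficient_series e e; pose S := coefficient_series e f.
pose S' := coefficient_series f e.
have Pa : adjoint P P by exact: adjoint_coefficient_series.
have Sa : adjoint S S' by exact: adjoint_coefficient_series.
have Pe x i : '[x - P x, e i] = 0.
  by rewrite dotDl dotNl dot_coefficient_series// subrr.
have L_iso : isometric (fun x => (x - P x) + S x).
  move=> x y; rewrite dotDl !(dotDr _ (S y)).
  have -> : '[x - P x, S y] = 0.
    apply: dotC0; rewrite Sa /S' coefficient_series_orth ?dot0r// => i.
    exact: Pe.
  have -> : '[S x, y - P y] = 0.
    rewrite Sa /S' coefficient_series_orth ?dot0r// => i.
    exact: Pe.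
  rewrite addr0 add0r Sa /S' /S coefficient_series_comp// -/(P y).
  have -> : '[x - P x, y - P y] = '[x, y - P y].
    have z0 : P (y - P y) = 0 by apply: coefficient_series_orth => i; exact: Pe.
    by rewrite dotDl dotNl Pa z0 dot0r subr0.
  by rewrite -dotDr subrK.
exists (fun x => (x - P x) + S x), e; split => //.
- split; last by exists 1 => //; exact: isometric_bounded.
  exists (fun x => (x - P x) + S' x) => x y.
  by rewrite !dotE Pa Sa.
- move=> x xs; split; last by move=> k; exact: es.
  have ex i : '[x, e i] = 0 by apply: dotC0; exact: es.
  by rewrite /P /S !coefficient_series_orth// subr0 addr0.
- move=> x k km; rewrite dotDl Pe add0r Sa /S' coefficient_series_orth ?dot0r// => i.
  by rewrite oe ltn_eqF// ltn_addl.
Qed.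
(** * Construction of 2-isometries *)

(** The operator identity of a 2-isometry, read through the inner product. *)
Definition two_isometric (S : H -> H) :=
  forall x y, '[x, y] - 2 * '[S x, S y] + '[S (S x), S (S y)] = 0.

(** With V x = sum <x, p_i> v_i the hypotheses make the three summands of the
    operator orthogonal, so <S x, S y> = <x, y> + <V x, V y>. Also
    <S x, p_i> = <x, p_i>, so V S = V: the defect <V x, V y> does not change when
    x and y are replaced by S x and S y. *)
Lemma two_isometric_model m (L U : H -> H) (p v : nat -> H) :
  isometric L -> isometric U -> orthonormal_upto m p ->
  (forall i, (i < m)%N -> L (p i) = p i) ->
  (forall i, (i < m)%N -> U (p i) = p i) ->
  (forall x i, (i < m)%N -> '[L x, v i] = 0) ->
  (forall i j, (i < m)%N -> (j < m)%N -> '[v i, p j] = 0) ->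
  two_isometric (fun x => U (L (x - finite_rank m p p x) +
    (finite_rank m p v x + finite_rank m p p x))).
Proof.
move=> L_iso U_iso op Lp Up Lv vp.
pose P := finite_rank m p p; pose V := finite_rank m p v.
pose S x := U (L (x - P x) + (V x + P x)).
have LcP x i : (i < m)%N -> '[L (x - P x), p i] = 0.
  move=> im; rewrite -{1}(Lp i im) L_iso dotDl dotNl dot_finite_rank_basis//.
  by rewrite subrr.
have Vp x i : (i < m)%N -> '[V x, p i] = 0.
  move=> im; rewrite dot_finite_rankl big1// => j _.
  by rewrite vp ?mulr0.
have orth x y w : (forall i, (i < m)%N -> '[x, w i] = 0) ->
    '[x, finite_rank m p w y] = 0.
  by move=> xw; rewrite dot_sumr big1// => i _; rewrite dotZr xw ?mulr0.
have SS x y : '[S x, S y] = '[x, y] + '[V x, V y].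
  have h1 : '[L (x - P x), V y] = 0 by apply: orth => i; exact: Lv.
  have h2 : '[L (x - P x), P y] = 0 by apply: orth => i; exact: LcP.
  have h3 : '[V x, P y] = 0 by apply: orth => i; exact: Vp.
  have h1' : '[V x, L (y - P y)] = 0.
    by apply: dotC0; apply: orth => i; exact: Lv.
  have h2' : '[P x, L (y - P y)] = 0.
    by apply: dotC0; apply: orth => i; exact: LcP.
  have h3' : '[P x, V y] = 0 by apply: dotC0; apply: orth => i; exact: Vp.
  have h4 := dot_orthogonal_component x y op; rewrite -L_iso -/P in h4.
  have h5 := dot_finite_rank2 p p x y op; rewrite -/P in h5.
  rewrite U_iso; move: h1 h2 h3 h1' h2' h3' h4 h5.
  move: (L (x - P x)) (L (y - P y)) (P x) (P y) (V x) (V y).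
  move=> a a' b b' c c' h1 h2 h3 h1' h2' h3' h4 h5.
  rewrite !(dotDl, dotDr) h1 h2 h3 h1' h2' h3' h4 h5; ring.
have VS x : V (S x) = V x.
  apply: eq_bigr => i _; congr (_ *: _).
  have im := ltn_ord i; rewrite -{1}(Up i im) U_iso dotDl LcP// add0r.
  by rewrite dotDl Vp// add0r dot_finite_rank_basis.
by move=> x y; rewrite -![U _]/(S _) !SS !VS; ring.
Qed.

Hypothesis sqrt_ex : forall a : K, 0 <= a -> exists2 b, 0 <= b & b ^+ 2 = a.

Lemma mem_map_iota (A : eqType) (F : nat -> A) n i : (i < n)%N ->
  F i \in [seq F i | i <- iota 0 n].
Proof. by move=> im; rewrite map_f// mem_iota. Qed.

Lemma map_iota_inv (A : eqType) (F : nat -> A) n y :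
  y \in [seq F i | i <- iota 0 n] -> exists2 i, (i < n)%N & y = F i.
Proof. by case/mapP=> i; rewrite mem_iota => im ->; exists i. Qed.

Lemma linear_morphism (f : H -> H) : linear f ->
  [/\ forall c u, f (c *: u) = c *: f u, forall u w, f (u + w) = f u + f w &
      forall u w, f (u - w) = f u - f w].
Proof.
move=> f_lin; have f0 : f 0 = 0.
  by have := f_lin (-1) 0 0; rewrite scaler0 addr0 scaleN1r addNr.
have fZ c u : f (c *: u) = c *: f u by rewrite -[c *: u]addr0 f_lin f0 addr0.
have fD u w : f (u + w) = f u + f w by have := f_lin 1 u w; rewrite !scale1r.
by split=> // u w; rewrite fD -!scaleN1r fZ.
Qed.

(** Application of the model to the tilted vectors p_i = b x_i + a q_i. The
    factor b = <x_i, p_i> is compensated by v_i = b^-1 c_i, so that S adds to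
    the component h_i of x_i the vector c_i, of size independent of b. The Gram
    matrix of the c_i is dictated by the requirement that h_i + c_i and the
    target z_i have the same Gram matrices. What remains of the error is that
    z_i is only a component of T x_i, and the summand b p_i. *)
Lemma two_isometric_interpolation m (x : nat -> H) (T : H -> H) (b : K) :
  orthonormal_upto m x -> linear T -> (forall y, `|y| <= `|T y|) ->
  0 < b -> b < 1 ->
  exists S, [/\ bounded_adjointable S, two_isometric S &
    forall i, (i < m)%N -> `|S (x i) - T (x i)| <= b * (1 + `|T (x i)| *+ m)].
Proof.
move=> ox T_lin T_exp b0 b1.
have b_neq0 := lt0r_neq0 b0.
have bc : conj b = b by apply: (conj_ge0 conj_norm); exact: ltW.
have [a a0 a2] : exists2 a, 0 <= a & a ^+ 2 = 1 - b ^+ 2.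
  by apply: sqrt_ex; rewrite subr_ge0 expr_le1// ltW.
have ac := conj_ge0 conj_norm a0.
have [q [oq' qs]] := exists_orthonormal_sequence
  ([seq x i | i <- iota 0 m] ++ [seq T (x i) | i <- iota 0 m]).
have oq := oq' m.
have qx k i : (i < m)%N -> '[q k, x i] = 0.
  by move=> im; apply: qs; rewrite mem_cat map_f// mem_iota.
have qT k i : (i < m)%N -> '[q k, T (x i)] = 0.
  move=> im; apply: qs; rewrite mem_cat; apply/orP; right.
  by apply: map_f; rewrite mem_iota.
pose p i := b *: x i + a *: q i.
have op : orthonormal_upto m p.
  move=> i j im jm; rewrite /p !dotE ox// oq// qx// (dotC0 (qx j i im)) bc ac.
  rewrite !mulr0 addr0 add0r !mulrA -mulrDl -!expr2 a2.
  by rewrite addrC subrK mul1r.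
have xp i j : (i < m)%N -> (j < m)%N -> '[x i, p j] = b * (i == j)%:R.
  by move=> im jm; rewrite /p !dotE ox// bc (dotC0 (qx j i im)) mulr0 addr0.
have [L [g [L_adj L_iso og Ls Lg]]] := exists_shift
  ([seq x i | i <- iota 0 m] ++ [seq q i | i <- iota 0 m]) m.
have L_lin : linear L by case: L_adj => -[L' /adjoint_linear].
have Lx i : (i < m)%N -> L (x i) = x i /\ forall k, '[g k, x i] = 0.
  by move=> im; apply: Ls; rewrite mem_cat map_f// mem_iota.
have Lq i : (i < m)%N -> L (q i) = q i /\ forall k, '[g k, q i] = 0.
  by move=> im; apply: Ls; rewrite mem_cat (map_f q) ?orbT// mem_iota.
have [LZ LD LB] := linear_morphism L_lin.
have Lp i : (i < m)%N -> L (p i) = p i.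
  by move=> im; rewrite LD !LZ (Lx i im).1 (Lq i im).1.
have gp k i : (i < m)%N -> '[g k, p i] = 0.
  by move=> im; rewrite /p !dotE (Lx i im).2 (Lq i im).2 !mulr0 addr0.
(* at u = x i, w = x j this is <z_i, z_j> - <h_i, h_j>, in a form that is
   positive on the whole space *)
pose B u w := '[T u, T w] - b ^+ 2 * (\sum_(j < m) '[T u, x j] * '[x j, T w])
  - a ^+ 2 * '[u, w].
have B_psd : psd_form conj B.
  split=> [c u w y|u w|u].
  - rewrite /B T_lin !dotE.
    have -> : \sum_(j < m) '[c *: T u + T w, x j] * '[x j, T y] =
        c * (\sum_(j < m) '[T u, x j] * '[x j, T y]) +
        \sum_(j < m) '[T w, x j] * '[x j, T y].
      rewrite mulr_sumr -big_split; apply: eq_bigr => j _ /=.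
      by rewrite !dotE; ring.
    ring.
  - rewrite /B !rmorphB !rmorphM bc ac !dotC rmorph_sum -!expr2.
    congr (_ - _ * _ - _); apply: eq_bigr => j _.
    by rewrite rmorphM !dotC mulrC.
  - have h1 := bessel (T u) ox.
    have h2 : '[u, u] <= '[T u, T u] by rewrite -!hdot ler_sqr ?nnegrE.
    rewrite /B -addrA -opprD subr_ge0.
    rewrite -[leRHS]mul1r -(subrK (b ^+ 2) 1) -a2 mulrDl addrC.
    by rewrite lerD// ler_wpM2l// exprn_ge0// ltW.
have [phi [_ phiE]] := psd_gram conjK conj_norm sqrt_ex m x B_psd.
pose c i := \sum_(k < m) phi k (x i) *: g k.
have cg w i : (forall k, (k < m)%N -> '[w, g k] = 0) -> '[w, c i] = 0.
  by move=> wg; rewrite dot_sumr big1// => k _; rewrite dotZr wg ?mulr0.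
have cc i j : (i < m)%N -> '[c i, c j] = B (x i) (x j).
  move=> im; rewrite phiE// dot_suml; apply: eq_bigr => k _.
  rewrite dotZl dot_sumr; congr (_ * _).
  rewrite -(sum_delta (fun l => conj (phi l (x j))) (ltn_ord k)).
  by apply: eq_bigr => l _; rewrite dotZr og// eq_sym.
pose P := finite_rank m p p.
pose h i := x i - P (x i).
pose z i := T (x i) - P (T (x i)).
have Px i : (i < m)%N -> P (x i) = b *: p i.
  move=> im; apply: finite_rank_eval => // j jm.
  by rewrite xp// eq_sym.
have Tp i j : (i < m)%N -> (j < m)%N -> '[T (x i), p j] = b * '[T (x i), x j].
  by move=> im jm; rewrite /p !dotE bc (dotC0 (qT j i im)) mulr0 addr0.
have hh i j : (i < m)%N -> (j < m)%N -> '[h i, h j] = a ^+ 2 * '[x i, x j].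
  move=> im jm; rewrite dot_orthogonal_component// a2 mulrBl mul1r; congr (_ - _).
  rewrite ox// -[RHS](sum_delta (fun k => b ^+ 2 * (i == k)%:R) jm).
  apply: eq_bigr => k _; rewrite xp// -dotC xp// rmorphM rmorph_nat bc.
  by rewrite (eq_sym j); ring.
have zz i j : (i < m)%N -> (j < m)%N -> '[z i, z j] =
    '[T (x i), T (x j)] - b ^+ 2 * (\sum_(k < m) '[T (x i), x k] * '[x k, T (x j)]).
  move=> im jm; rewrite dot_orthogonal_component//; congr (_ - _).
  rewrite mulr_sumr; apply: eq_bigr => k _.
  by rewrite Tp// -[X in _ * X]dotC Tp// rmorphM bc dotC; ring.
have orthP u i : (i < m)%N -> '[u - P u, p i] = 0.
  by move=> im; rewrite dotDl dotNl dot_finite_rank_basis// subrr.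
have hg i k : (i < m)%N -> '[h i, g k] = 0.
  move=> im; rewrite /h Px// dotDl dotNl dotZl (dotC0 (gp k i im)).
  by rewrite (dotC0 ((Lx i im).2 k)) mulr0 subr0.
have pc i j : (i < m)%N -> '[p i, c j] = 0.
  by move=> im; apply: cg => k _; exact: dotC0 (gp k i im).
have hc i j : (i < m)%N -> '[h i, c j] = 0.
  by move=> im; apply: cg => k _; exact: hg.
have [|U [U_adj U_iso Us]] := @isometry_extension
  ([seq (p i, p i) | i <- iota 0 m] ++ [seq (h i + c i, z i) | i <- iota 0 m]).
  have hp i j : (i < m)%N -> (j < m)%N -> '[h i + c i, p j] = '[z i, p j].
    move=> im jm; rewrite dotDl /h /z !orthP// add0r.
    exact: dotC0 (pc j i jm).
  move=> u w; rewrite !mem_cat => /orP[] /map_iota_inv[i im ->]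
    /orP[] /map_iota_inv[j jm ->] /=.
  - by [].
  - by rewrite -[LHS]dotC hp// dotC.
  - exact: hp.
  - rewrite zz// dotDl !(dotDr (h j)) hh// hc// (dotC0 (hc j i jm)) cc// /B; ring.
have U_lin : linear U by case: U_adj => -[U' /adjoint_linear].
have [UZ UD _] := linear_morphism U_lin.
have Up i : (i < m)%N -> U (p i) = p i.
  move=> im; apply: (Us (p i, p i)); rewrite mem_cat; apply/orP; left.
  exact: (mem_map_iota (fun i => (p i, p i))).
have Uh i : (i < m)%N -> U (h i + c i) = z i.
  move=> im; apply: (Us (h i + c i, z i)); rewrite mem_cat; apply/orP; right.
  exact: (mem_map_iota (fun i => (h i + c i, z i))).
pose v i := b^-1 *: c i.
pose S y := U (L (y - P y) + (finite_rank m p v y + P y)).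
have Sx i : (i < m)%N -> S (x i) = z i + b *: p i.
  move=> im; rewrite /S addrA UD.
  have -> : finite_rank m p v (x i) = c i.
    rewrite (@finite_rank_eval _ _ _ _ b i)//; last first.
      by move=> j jm; rewrite xp// eq_sym.
    by rewrite scalerA divff// scale1r.
  have -> : L (x i - P (x i)) = h i.
    by rewrite LB Px// LZ Lp// (Lx i im).1 /h Px.
  by rewrite Uh// Px// UZ Up.
exists S; split.
- apply: (@bounded_adjointable_comp U) => //.
  apply: bounded_adjointableD; last first.
    by apply: bounded_adjointableD; exact: bounded_adjointable_finite_rank.
  apply: (@bounded_adjointable_comp L) => //.
  apply: bounded_adjointableD; first exact: bounded_adjointable_id.
  exact/bounded_adjointableN/bounded_adjointable_finite_rank.
- apply: (@two_isometric_model m L U p v) => //.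
  + move=> y i im; rewrite dotZr cg ?mulr0// => k km.
    exact: Lg.
  + by move=> i j im jm; rewrite dotZl (dotC0 (pc j i jm)) mulr0.
- move=> i im; rewrite Sx// /z.
  have -> : T (x i) - P (T (x i)) + b *: p i - T (x i) = b *: p i - P (T (x i)).
    by rewrite addrAC [T (x i) - _]addrC addrK addrC.
  have p1 j : (j < m)%N -> `|p j| = 1.
    by move=> jm; apply: normr_dot1; rewrite op// eqxx.
  rewrite (le_trans (ler_normB _ _))// mulrDr lerD//.
    by rewrite normrZ p1// gtr0_norm ?mulr1.
  rewrite (le_trans (ler_norm_sum _ _ _))// -[X in _ *+ X]card_ord -sumr_const mulr_sumr.
  apply: ler_sum => j _; rewrite normrZ p1// mulr1 Tp// normrM gtr0_norm//.
  apply: ler_wpM2l; first exact: ltW.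
  apply: le_trans (cauchy_schwarz _ _) _.
  by rewrite (normr_dot1 (u := x j)) ?mulr1// ox// eqxx.
Qed.

(** Every vector of [s] is a combination of an orthonormal family, and the error
    on it is at most b C, with C independent of b; b = eps / (eps + M) is
    less than 1 and makes b C less than eps as soon as C < M. *)
Lemma two_isometric_approximation (T : H -> H) (s : seq H) (eps : K) :
  linear T -> (forall y, `|y| <= `|T y|) -> 0 < eps ->
  exists S, [/\ bounded_adjointable S, two_isometric S &
    forall x, x \in s -> `|S x - T x| < eps].
Proof.
move=> T_lin T_exp eps0; have [m [o [oo os]]] := gram_schmidt s.
pose C x := \sum_(i < m) `|'[x, o i]| * (1 + `|T (o i)| *+ m).
have C0 x : 0 <= C x.
  by apply: sumr_ge0 => i _; rewrite mulr_ge0// addr_ge0// mulrn_wge0.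
have [M M0 CM] : exists2 M, 0 < M & forall x, x \in s -> C x < M.
  elim: s {os} => [|x s' [M M0 CM]]; first by exists 1.
  have CxM y : C y < C y + M by rewrite ltrDl.
  exists (C x + M) => [|y]; first exact: le_lt_trans (C0 x) (CxM x).
  rewrite inE => /orP[/eqP-> //|/CM yM].
  by apply: lt_le_trans yM _; rewrite lerDr.
have eM : 0 < eps + M by rewrite addr_gt0.
pose b := eps / (eps + M).
have b0 : 0 < b by rewrite divr_gt0.
have b1 : b < 1 by rewrite ltr_pdivrMr// mul1r ltrDl.
have [S [S_adj S_two So]] := two_isometric_interpolation oo T_lin T_exp b0 b1.
exists S; split=> // x xs.
have S_lin : linear S by case: S_adj => -[S' /adjoint_linear].
have [TZ TD _] := linear_morphism T_lin.
have [SZ SD _] := linear_morphism S_lin.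
have sumE f : (forall c u, f (c *: u) = c *: f u) ->
    (forall u w, f (u + w) = f u + f w :> H) ->
    f x = \sum_(i < m) '[x, o i] *: f (o i).
  move=> fZ fD; rewrite -{1}(os x xs).
  rewrite (big_morph f fD (_ : f 0 = 0)) => [|]; last by rewrite -(scale0r 0) fZ !scale0r.
  by apply: eq_bigr => i _; exact: fZ.
rewrite (sumE _ SZ SD) (sumE _ TZ TD) -sumrB.
apply: le_lt_trans (ler_norm_sum _ _ _) _.
apply: (@le_lt_trans _ _ (b * C x)).
  rewrite mulr_sumr; apply: ler_sum => i _.
  by rewrite -scalerBr normrZ mulrCA ler_wpM2l// So.
rewrite /b mulrAC ltr_pdivrMr// ltr_pM2l// (lt_le_trans (CM x xs))//.
by rewrite lerDr ltW.
Qed.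

(** * Expansivity of 2-isometries *)

(** The defect <S y, S y> - <y, y> is constant along orbits of S. If it were
    negative, <S^n x, S^n x> would be negative for large n. *)
Lemma two_isometric_expansive (S : H -> H) : two_isometric S ->
  forall x, `|x| <= `|S x|.
Proof.
move=> S_two x; pose D y := '[S y, S y] - '[y, y].
have DS y : D (S y) = D y.
  by apply/eqP; rewrite -subr_eq0 -(S_two y y) /D; apply/eqP; ring.
have Dn n : D (iter n S x) = D x by elim: n => //= n IHn; rewrite DS.
have Sn n : '[iter n S x, iter n S x] = '[x, x] + D x *+ n.
  elim: n => [|n IHn]; first by rewrite addr0.
  by rewrite iterS mulrSr addrA -IHn -{1}(Dn n) /D addrC subrK.
have [//|lt] := real_leP (normr_real x) (normr_real (S x)).
have D0 : 0 < - D x by rewrite /D opprB subr_gt0 -!hdot ltr_sqr ?nnegrE.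
have [n] := archimedean ('[x, x] / - D x).
rewrite ger0_norm; last by rewrite divr_ge0 ?(ltW D0)// -hdot exprn_ge0.
rewrite ltr_pdivrMr// mulr_natl mulNrn => /lt_geF <-.
by rewrite -subr_ge0 opprK -Sn -hdot exprn_ge0.
Qed.

(** * The closure in the strong operator topology *)

Lemma evaluation_continuous (x : H) :
  continuous (fun S : bounded_operator H => S x).
Proof.
move=> S; apply: (@continuous_comp _ _ _ set_val (fun f : {ptws H -> H} => f x)).
  exact: initial_continuous.
exact: proj_continuous.
Qed.

(** The sets of operators close to [T] on a finite list generate a filter that
    converges pointwise to [T], hence is finer than the neighbourhood filter. *)
Lemma sot_closure (A : set (bounded_operator H)) (T : bounded_operator H) :
  (forall (s : seq H) (eps : K), 0 < eps ->
    exists2 S, A S & forall x, x \in s -> `|S x - T x| < eps) ->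
  closure A T.
Proof.
move=> approx B [_ [/= [W oW <-] WT] WB].
pose F : set_system (bounded_operator H) := [set C | exists (s : seq H),
  exists2 eps : K, 0 < eps &
    [set S : bounded_operator H | forall x, x \in s -> `|S x - T x| < eps] `<=` C].
have F_filter : Filter F.
  split=> [|C C' [s [e e0 sC]] [s' [e' e'0 sC']]|C C' CC' [s [e e0 sC]]].
  - by exists [::], 1.
  - have [d d0 [de de']] : exists2 d : K, 0 < d & d <= e /\ d <= e'.
      have [ee'|/ltW e'e] := real_leP (gtr0_real e0) (gtr0_real e'0).
        by exists e.
      by exists e'.
    exists (s ++ s'), d => // S /= Sd; split.
      by apply: sC => x xs; apply: lt_le_trans de; apply: Sd; rewrite mem_cat xs.
    apply: sC' => x xs; apply: lt_le_trans de'; apply: Sd.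
    by rewrite mem_cat xs orbT.
  - by exists s, e => // S /sC/CC'.
have Fcvg : {ptws, set_val @ F --> set_val T}.
  apply/pointwise_cvgP => x; apply/cvgrPdist_lt => eps eps0.
  exists [:: x], eps => // S /= Sx.
  by rewrite distrC; apply: Sx; rewrite inE.
have [s [eps eps0 sB]] : F B.
  by apply: filterS WB _; apply: Fcvg; exact: open_nbhs_nbhs.
by have [S AS Ss] := approx s eps eps0; exists S; split=> //; exact: sB.
Qed.

Lemma two_isometryP (T : bounded_operator H) :
  two_isometry dot T <-> (exists g, adjoint T g) /\ two_isometric T.
Proof.
split=> [[S TS Sz]|[[g Tg] T_two]].
  split=> [|x y]; first by exists S.
  rewrite -[RHS](dot0l y) -(Sz x) !dotE !(adjointC TS); ring.
have [M Mb] : exists M, forall x, `|T x| <= M * `|x|.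
  by have [_] : bounded_linear (T : {ptws H -> H}) by exact: set_valP.
have g_bl : bounded_linear (g : {ptws H -> H}).
  split; first exact: adjoint_linear (adjointC Tg).
  by exists M; exact: adjoint_bounded Tg Mb.
exists (SigSub (mem_set g_bl)) => // x; apply: dot_inj => y.
rewrite dot0l -[RHS](T_two x y) !dotE /= !(adjointC Tg); ring.
Qed.

Theorem expansive_closure :
  [set T : bounded_operator H | forall x : H, `|x| <= `|T x|]
  = closure [set T : bounded_operator H | two_isometry dot T].
Proof.
apply/seteqP; split=> T /=.
  move=> T_exp; apply: sot_closure => s eps eps0.
  have [T_lin _] : bounded_linear (T : {ptws H -> H}) by exact: set_valP.
  have [S [[S_adj [M M0 SM]] S_two Ss]] := two_isometric_approximation s T_lin T_exp eps0.
  have S_bl : bounded_linear (S : {ptws H -> H}).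
    by split; [case: S_adj => S' /adjoint_linear | exists M].
  exists (SigSub (mem_set S_bl)) => //=.
  exact/two_isometryP.
move=> clT x; have [//|lt] := real_leP (normr_real x) (normr_real (T x)).
have e0 : 0 < `|x| - `|T x| by rewrite subr_gt0.
have /cvgrPdist_lt/(_ _ e0) near_T := @evaluation_continuous x T.
have [S [/two_isometryP[_ /two_isometric_expansive/(_ x) S_exp] /= ST]] := clT _ near_T.
suff : `|x| < `|x| by rewrite ltxx.
apply: le_lt_trans S_exp _; rewrite -[ltRHS](subrK `|T x|).
rewrite -(ltrD2r `|T x|) in ST.
apply: le_lt_trans ST.
by rewrite distrC -[X in `|X| <= _](subrK (T x)) ler_normD.
Qed.

End InnerProduct.
(** * Real and complex scalars *)

Lemma complex_archimedean (R : realType) (a : R[i]) : exists n : nat, `|a| < n%:R.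
Proof.
have [r r0 ->] : exists2 r : R, 0 <= r & `|a| = r%:C%C.
  by case: a => x y; rewrite normc_def; eexists; last reflexivity; exact: sqrtr_ge0.
exists (Num.bound r); rewrite -(rmorph_nat (real_complex R)) ltcR.
exact: archi_boundP.
Qed.

Theorem theorem7 (R : realType) (K : numFieldType) (conj : K -> K)
    (hK : real_or_complex R conj)
    (H : completeNormedModType K) (dot : {dot H for conj})
    (hdot : forall x : H, `|x| ^+ 2 = dot x x)
    (hH : infinite_dimensional H) :
  [set T : bounded_operator H | forall x : H, `|x| <= `|T x|]
  = closure [set T : bounded_operator H | two_isometry dot T].
Proof.
case: hK H dot hdot hH => H dot hdot hH.
  apply: (@expansive_closure R idfun) => //.
  - by move=> a; rewrite real_normK ?num_real.
  - by move=> a; exists (Num.bound `|a|); exact: archi_boundP.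
  - by move=> a a0; exists (Num.sqrt a); rewrite ?sqrtr_ge0 ?sqr_sqrtr.
apply: (@expansive_closure R[i] (@Num.conj R[i])) => //.
- exact: conjCK.
- exact: normCK.
- exact: complex_archimedean.
- by move=> a a0; exists (sqrtC a); rewrite ?sqrtC_ge0 ?sqrtCK.
Qed.
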